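(* Assume that there is a countable transitive model of $\mathsf{ZFC}$. Then $\mathsf{IZF}$ has the de Jongh property, i.e. $\mathbf{L}(\mathsf{IZF}) = \mathbf{IPC}$: for every propositional formula $\phi$, $\mathbf{IPC} \vdash \phi$ if and only if $\mathsf{IZF}\vdash\phi^\sigma$ for all assignments $\sigma$ of sentences of the language of set theory to propositional variables.
   Context: The meta-theory is classical $\mathsf{ZFC}$ (together with the existence of a countable transitive model of $\mathsf{ZFC}$). Fix a countable set $\mathrm{Prop}$ of propositional variables; $\mathbf{IPC}$ is intuitionistic propositional logic, identified with its set of theorems. For $\sigma:\mathrm{Prop}\to\mathcal{L}_\in^{\mathrm{sent}}$ (sentences of the language $\mathcal{L}_\in$ of set theory), $\phi^\sigma$ is obtained from $\phi$ by replacing each propositional variable $p$ by $\sigma(p)$. For a theory $\mathsf{T}$ in intuitionistic predicate logic in the language $\mathcal{L}_\in$, $\mathbf{L}(\mathsf{T})$ is the set of propositional formulas $\phi$ with $\mathsf{T}\vdash\phi^\sigma$ for all such $\sigma$; $\mathsf{T}$ has the de Jongh property if $\mathbf{L}(\mathsf{T})=\mathbf{IPC}$. $\mathsf{IZF}$ is the theory in intuitionistic predicate logic with equality in the language $\mathcal{L}_\in$ with axioms: Extensionality $\forall a\forall b(\forall x(x\in a\leftrightarrow x\in b)\to a=b)$; Empty set $\exists a\,\forall x\in a\,\bot$; Pairing $\forall a\forall b\exists y\forall x(x\in y\leftrightarrow(x=a\vee x=b))$; Union $\forall a\exists y\forall x(x\in y\leftrightarrow\exists u(u\in a\wedge x\in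 u))$; Power set $\forall a\exists y\forall x(x\in y\leftrightarrow x\subseteq a)$; Infinity $\exists a(\exists x\,x\in a\wedge\forall x\in a\,\exists y\in a\,x\in y)$; Set Induction $(\forall a(\forall x\in a\,\phi(x)\to\phi(a)))\to\forall a\,\phi(a)$ for all formulas $\phi(x)$; Separation $\forall a\exists y\forall x(x\in y\leftrightarrow(x\in a\wedge\phi(x)))$ for all formulas $\phi(x)$; Collection $\forall a(\forall x\in a\,\exists y\,\phi(x,y)\to\exists b\,\forall x\in a\,\exists y\in b\,\phi(x,y))$ for all formulas $\phi(x,y)$ in which $b$ is not free. *)

(* Defs.v *)
From Stdlib Require List.
From mathcomp Require Import all_boot.

Set Implicit Arguments.
Unset Strict Implicit.
Unset Printing Implicit Defensive.

Inductive pform (P : Type) : Type :=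
| pVar of P
| pBot
| pAnd of pform P & pform P
| pOr  of pform P & pform P
| pImp of pform P & pform P.

Arguments pBot {P}.

Inductive pnd (P : Type) : seq (pform P) -> pform P -> Prop :=
| pnd_ax G A : List.In A G -> pnd G A
| pnd_botE G A : pnd G pBot -> pnd G A
| pnd_andI G A B : pnd G A -> pnd G B -> pnd G (pAnd A B)
| pnd_andE1 G A B : pnd G (pAnd A B) -> pnd G A
| pnd_andE2 G A B : pnd G (pAnd A B) -> pnd G B
| pnd_orI1 G A B : pnd G A -> pnd G (pOr A B)
| pnd_orI2 G A B : pnd G B -> pnd G (pOr A B)
| pnd_orE G A B C :
    pnd G (pOr A B) -> pnd (A :: G) C -> pnd (B :: G) C -> pnd G C
| pnd_impI G A B : pnd (A :: G) B -> pnd G (pImp A B)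
| pnd_impE G A B : pnd G (pImp A B) -> pnd G A -> pnd G B.

Definition IPC (P : Type) (A : pform P) : Prop := pnd [::] A.

(* Formulas of the language of set theory, with de Bruijn indices: the
   innermost quantifier binds index 0.  The language has no function symbols,
   so the only terms are variables. *)
Inductive form : Type :=
| fMem of nat & nat
| fEq  of nat & nat
| fBot
| fAnd of form & form
| fOr  of form & form
| fImp of form & form
| fAll of form
| fEx  of form.

Definition fIff A B := fAnd (fImp A B) (fImp B A).

(* In the bounded quantifiers, i is an index outside the new binder. *)
Definition fAllIn i A := fAll (fImp (fMem 0 i.+1) A).
Definition fExIn i A := fEx (fAnd (fMem 0 i.+1) A).

Definition scons (T : Type) (x : T) (f : nat -> T) (i : nat) : T :=
  if i is j.+1 then f j else x.

Definition up (f : nat -> nat) : nat -> nat := scons 0 (fun i => (f i).+1).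

Fixpoint ren (f : nat -> nat) (A : form) : form :=
  match A with
  | fMem i j => fMem (f i) (f j)
  | fEq i j => fEq (f i) (f j)
  | fBot => fBot
  | fAnd A B => fAnd (ren f A) (ren f B)
  | fOr A B => fOr (ren f A) (ren f B)
  | fImp A B => fImp (ren f A) (ren f B)
  | fAll A => fAll (ren (up f) A)
  | fEx A => fEx (ren (up f) A)
  end.

Definition inst (A : form) (t : nat) : form := ren (scons t id) A.

(* The least n such that all free indices of A are below n. *)
Fixpoint fvbound (A : form) : nat :=
  match A with
  | fMem i j | fEq i j => maxn i.+1 j.+1
  | fBot => 0
  | fAnd A B | fOr A B | fImp A B => maxn (fvbound A) (fvbound B)
  | fAll A | fEx A => (fvbound A).-1
  end.

Definition sentence (A : form) : Prop := fvbound A = 0.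

Definition uclosure (A : form) : form := iter (fvbound A) fAll A.

(* Intuitionistic natural deduction with equality. *)
Inductive nd : seq form -> form -> Prop :=
| nd_ax G A : List.In A G -> nd G A
| nd_botE G A : nd G fBot -> nd G A
| nd_andI G A B : nd G A -> nd G B -> nd G (fAnd A B)
| nd_andE1 G A B : nd G (fAnd A B) -> nd G A
| nd_andE2 G A B : nd G (fAnd A B) -> nd G B
| nd_orI1 G A B : nd G A -> nd G (fOr A B)
| nd_orI2 G A B : nd G B -> nd G (fOr A B)
| nd_orE G A B C : nd G (fOr A B) -> nd (A :: G) C -> nd (B :: G) C -> nd G C
| nd_impI G A B : nd (A :: G) B -> nd G (fImp A B)
| nd_impE G A B : nd G (fImp A B) -> nd G A -> nd G B
| nd_allI G A : nd (map (ren S) G) A -> nd G (fAll A)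
| nd_allE G A t : nd G (fAll A) -> nd G (inst A t)
| nd_exI G A t : nd G (inst A t) -> nd G (fEx A)
| nd_exE G A B : nd G (fEx A) -> nd (A :: map (ren S) G) (ren S B) -> nd G B
| nd_eqI G t : nd G (fEq t t)
| nd_eqE G A s t : nd G (fEq s t) -> nd G (inst A s) -> nd G (inst A t).

(* A theory is given by its axioms, which are meant to be sentences; schemes
   with parameters are therefore universally closed. *)
Definition theory := form -> Prop.

Definition proves (T : theory) (A : form) : Prop :=
  exists2 G : seq form, (forall B, List.In B G -> T B) & nd G A.

Fixpoint ptrans (P : Type) (s : P -> form) (A : pform P) : form :=
  match A with
  | pVar p => s p
  | pBot => fBot
  | pAnd A B => fAnd (ptrans s A) (ptrans s B)
  | pOr A B => fOr (ptrans s A) (ptrans s B)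
  | pImp A B => fImp (ptrans s A) (ptrans s B)
  end.

Definition prop_logic (P : Type) (T : theory) (A : pform P) : Prop :=
  forall s : P -> form, (forall p, sentence (s p)) -> proves T (ptrans s A).

Definition de_jongh_property (P : Type) (T : theory) : Prop :=
  forall A : pform P, prop_logic T A <-> IPC A.

Definition ax_ext : form :=
  fAll (fAll (fImp (fAll (fIff (fMem 0 2) (fMem 0 1))) (fEq 1 0))).

Definition ax_empty : form := fEx (fAllIn 0 fBot).

Definition ax_pair : form :=
  fAll (fAll (fEx (fAll (fIff (fMem 0 1) (fOr (fEq 0 3) (fEq 0 2)))))).

Definition ax_union : form :=
  fAll (fEx (fAll
    (fIff (fMem 0 1) (fEx (fAnd (fMem 0 3) (fMem 1 0)))))).

Definition ax_power : form :=
  fAll (fEx (fAll (fIff (fMem 0 1) (fAllIn 0 (fMem 0 3))))).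

Definition ax_infinity : form :=
  fEx (fAnd (fEx (fMem 0 1)) (fAllIn 0 (fExIn 1 (fMem 1 0)))).

(* In A, index 0 is x and the others are parameters; [ren (up S) A] inserts a
   fresh variable at index 1. *)
Definition ax_set_induction (A : form) : form :=
  fImp (fAll (fImp (fAllIn 0 (ren (up S) A)) A)) (fAll A).

(* In A, index 0 is x, index 1 is the set a, and the others are parameters;
   the renaming skips y, so that y is not free in A. *)
Definition ax_separation (A : form) : form :=
  fAll (fEx (fAll (fIff (fMem 0 1) (fAnd (fMem 0 2) (ren (up S) A))))).

(* In A, indices 0, 1, 2 are y, x, a and the others are parameters; the
   renaming skips b, so that b is not free in A. *)
Definition ax_collection (A : form) : form :=
  fAll (fImp (fAllIn 0 (fEx A))
             (fEx (fAllIn 1 (fExIn 1 (ren (up (up S)) A))))).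

Inductive IZF : theory :=
| IZF_ext : IZF ax_ext
| IZF_empty : IZF ax_empty
| IZF_pair : IZF ax_pair
| IZF_union : IZF ax_union
| IZF_power : IZF ax_power
| IZF_infinity : IZF ax_infinity
| IZF_set_induction A : IZF (uclosure (ax_set_induction A))
| IZF_separation A : IZF (uclosure (ax_separation A))
| IZF_collection A : IZF (uclosure (ax_collection A)).

(* There is an inductive set: it contains an empty set and, with each x, the
   set x \cup {x}. *)
Definition ax_inductive : form :=
  fEx (fAnd (fExIn 0 (fAllIn 0 fBot))
            (fAllIn 0 (fExIn 1
               (fAll (fIff (fMem 0 1) (fOr (fMem 0 2) (fEq 0 2))))))).

Definition ax_foundation : form :=
  fAll (fImp (fEx (fMem 0 1))
             (fExIn 0 (fAllIn 0 (fImp (fMem 0 2) fBot)))).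

(* In A, indices 0, 1, 2 are y, x, a, as in [ax_collection]; the hypothesis
   says that for each x in a there is exactly one y with A. *)
Definition ax_replacement (A : form) : form :=
  fAll (fImp (fAllIn 0 (fEx (fAll (fIff (ren (up S) A) (fEq 0 1)))))
             (fEx (fAllIn 1 (fExIn 1 (ren (up (up S)) A))))).

(* Every family of nonempty pairwise disjoint sets has a transversal. *)
Definition ax_choice : form :=
  fAll (fImp
    (fAnd (fAllIn 0 (fEx (fMem 0 1)))
          (fAllIn 0 (fAllIn 1
             (fImp (fEx (fAnd (fMem 0 2) (fMem 0 1))) (fEq 1 0)))))
    (fEx (fAllIn 1
       (fEx (fAll (fIff (fAnd (fMem 0 2) (fMem 0 3)) (fEq 0 1))))))).

Inductive ZFC : theory :=
| ZFC_ext : ZFC ax_ext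
| ZFC_empty : ZFC ax_empty
| ZFC_pair : ZFC ax_pair
| ZFC_union : ZFC ax_union
| ZFC_power : ZFC ax_power
| ZFC_inductive : ZFC ax_inductive
| ZFC_foundation : ZFC ax_foundation
| ZFC_separation A : ZFC (uclosure (ax_separation A))
| ZFC_replacement A : ZFC (uclosure (ax_replacement A))
| ZFC_choice : ZFC ax_choice.

(* The sets of the metatheory: well-founded trees, identified when they are
   bisimilar. *)
Inductive vset : Type := VSup (X : Type) of (X -> vset).

Fixpoint veq (x y : vset) : Prop :=
  match x, y with
  | VSup X f, VSup Y g =>
      (forall i, exists j, veq (f i) (g j)) /\
      (forall j, exists i, veq (f i) (g j))
  end.

Definition vmem (x y : vset) : Prop :=
  let: VSup Y g := y in exists j, veq x (g j).

Definition vtransitive (M : vset) : Prop :=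
  forall x y, vmem x y -> vmem y M -> vmem x M.

Definition vcountable (M : vset) : Prop :=
  exists e : nat -> vset, forall x, vmem x M -> exists n, veq x (e n).

(* Truth in the structure (M, \in); [r] gives the values of the free indices. *)
Fixpoint sat (M : vset) (r : nat -> vset) (A : form) : Prop :=
  match A with
  | fMem i j => vmem (r i) (r j)
  | fEq i j => veq (r i) (r j)
  | fBot => False
  | fAnd A B => sat M r A /\ sat M r B
  | fOr A B => sat M r A \/ sat M r B
  | fImp A B => sat M r A -> sat M r B
  | fAll A => forall x, vmem x M -> sat M (scons x r) A
  | fEx A => exists2 x, vmem x M & sat M (scons x r) A
  end.

(* [r] ranges over all assignments, not only those with values in M, so that
   the empty set is not vacuously a model; for sentences [r] is irrelevant. *)
Definition models (M : vset) (T : theory) : Prop :=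
  forall A, T A -> forall r, sat M r A.

(* Main.v *)
Require Import Defs.
From mathcomp Require Import all_boot.
From mathcomp Require Import boolp.

(** Intuitionistic propositional proofs translate line by line, so the point is
    to refute, for every formula [A] that is not a theorem of intuitionistic
    propositional logic, an instance of [A] in a model of IZF.

    Over any preorder [F] there is a Heyting-valued universe of sets, presented
    here as Kripke forcing over well-founded trees whose edges carry persistent
    predicates on [F] ([kset], [forces]). It satisfies IZF ([forces_IZF]). A set
    [p] can be used as the truth value of the statement that [p] is inhabited, and
    all persistent predicates occur in this way. A sentence of set theory can
    therefore quantify over propositions, and such sentences can describe the
    shape of [F].

    The sentence [no_antichain k] holds at a node exactly when no [k] pairwise
    incomparable nodes lie above it ([forces_no_antichain]). A ladder of width [d],
    that is, an infinite tower of levels of [d] incomparable nodes, each level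
    below the next, looks the same from all its nodes. (Without a highest level:
    maximal nodes could not be told apart by sentences.) Hence the sentence
    [width_is d] holds everywhere on a ladder of width [d], and nowhere on a
    ladder of another width.

    Let [W] be a finite Kripke model refuting [A] ([IPC_finite_countermodel], by
    prime sets of subformulas of [A]). Put above each world [v] a ladder whose
    width is used for no other world. Which ladders can be reached from a node is
    now expressible by sentences, and the world [w] lies below [v] exactly when
    the ladder of [v] can be reached from [w]. So all upward closed sets of worlds
    become definable ([forces_reach_sentence]). To keep the ladders from
    disturbing the truth of propositional formulas, the ladder of [v] imitates a
    maximal world above [v]: the frame is then mapped onto [W] by a bounded
    morphism, along which the valuation of [W] is pulled back
    ([ladder_countermodel]). The sentences that define the pulled back valuation
    give the refuted instance of [A]. *)

Set Implicit Arguments.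
Unset Strict Implicit.
Unset Printing Implicit Defensive.

(** * Finite Kripke completeness of intuitionistic propositional logic *)

Section PropositionalCompleteness.

Variable P : Type.
Implicit Types (A B C : pform P) (G : seq (pform P)).

Lemma pnd_weaken G A : pnd G A ->
  forall G', (forall B, List.In B G -> List.In B G') -> pnd G' A.
Proof.
have cons_sub C G1 G2 : (forall B, List.In B G1 -> List.In B G2) ->
    forall B, List.In B (C :: G1) -> List.In B (C :: G2).
  by move=> s B [->|/s]; [left | right].
elim=> {G A}.
- by move=> G A inG G' s; apply/pnd_ax/s.
- by move=> G A _ IH G' s; apply/pnd_botE/IH.
- by move=> G A B _ IHA _ IHB G' s; apply: pnd_andI; [apply: IHA | apply: IHB].
- by move=> G A B _ IH G' s; apply: (@pnd_andE1 _ _ A B); apply: IH.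
- by move=> G A B _ IH G' s; apply: (@pnd_andE2 _ _ A B); apply: IH.
- by move=> G A B _ IH G' s; apply/pnd_orI1/IH.
- by move=> G A B _ IH G' s; apply/pnd_orI2/IH.
- move=> G A B C _ IH _ IHA _ IHB G' s; apply: (@pnd_orE _ _ A B); first exact: IH.
    by apply: IHA; apply: cons_sub.
  by apply: IHB; apply: cons_sub.
- by move=> G A B _ IH G' s; apply: pnd_impI; apply: IH; apply: cons_sub.
- by move=> G A B _ IHA _ IHB G' s; apply: (@pnd_impE _ _ A B); [apply: IHA | apply: IHB].
Qed.

(** Antisymmetry is what makes a world maximal in the strong sense that it sees
    only itself; a ladder that imitates such a world depends on it. *)
Record kripke_poset := KripkePoset {
  world :> finType;
  wle : rel world;
  wle_refl : reflexive wle;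
  wle_trans : transitive wle;
  wle_anti : antisymmetric wle
}.

Fixpoint pforces (W : kripke_poset) (V : W -> P -> Prop) A (w : W) : Prop :=
  match A with
  | pVar p => V w p
  | pBot => False
  | pAnd A B => pforces V A w /\ pforces V B w
  | pOr A B => pforces V A w \/ pforces V B w
  | pImp A B => forall v, wle w v -> pforces V A v -> pforces V B v
  end.

Fixpoint subformulas A : seq (pform P) :=
  A :: match A with
       | pVar _ | pBot => [::]
       | pAnd B C | pOr B C | pImp B C => subformulas B ++ subformulas C
       end.

Lemma subformulas_self A : List.In A (subformulas A).
Proof. by case: A; left. Qed.

Section CanonicalModel.

Variable A0 : pform P.

Let Phi := subformulas A0.
Notation I := 'I_(size Phi).
Notation context := {set I}.
Implicit Types s t : context.

Definition axiom_of s B := exists2 i : I, i \in s & B = nth pBot Phi i.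

Definition derives s B :=
  exists2 G, (forall C, List.In C G -> axiom_of s C) & pnd G B.

Lemma derives_ax s B : axiom_of s B -> derives s B.
Proof.
by move=> sB; exists [:: B]; [move=> C [<-|[]] | apply: pnd_ax; left].
Qed.

Lemma derives_sub s t B : s \subset t -> derives s B -> derives t B.
Proof.
move=> /subsetP st [G sG GB]; exists G => // C /sG [i si ->].
by exists i => //; apply: st.
Qed.

Lemma derives0 B : derives set0 B -> IPC B.
Proof. by case=> [[|C G] sG //]; case: (sG C) => [|i]; [left | rewrite inE]. Qed.

(** A derivation may use the same axiom several times, or not at all, so its list
    of assumptions has to be normalised before the axiom is discharged. *)
Lemma derives_deduction s i B :
  derives (i |: s) B -> derives s (pImp (nth pBot Phi i) B).
Proof.
case=> G sG GB.
suff [G' sG' GG'] : exists2 G', (forall C, List.In C G' -> axiom_of s C)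
    & forall C, List.In C G -> List.In C (nth pBot Phi i :: G').
  by exists G' => //; apply/pnd_impI/(pnd_weaken GB).
elim: G sG {GB} => [|C G IH] sG; first by exists [::].
have [D GD|G' sG' GG'] := IH; first by apply: sG; right.
have [j] := sG C (or_introl erefl).
rewrite !inE => /orP[/eqP-> ->|sj ->].
  by exists G' => // D [<-|/GG' //]; left.
exists (nth pBot Phi j :: G') => [D [<-|/sG' //]|D [<-|/GG' []]].
- by exists j.
- by right; left.
- by left.
- by right; right.
Qed.

Lemma derives_mp s B C : derives s (pImp B C) -> derives s B -> derives s C.
Proof.
case=> [G sG GBC] [G' sG' G'B]; exists (G ++ G').
  by move=> D /(@List.in_app_or _ _ _ _)[/sG|/sG'].
apply: (@pnd_impE _ _ B).
  by apply: (pnd_weaken GBC) => D ?; apply: List.in_or_app; left.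
by apply: (pnd_weaken G'B) => D ?; apply: List.in_or_app; right.
Qed.

Lemma derives_map (B C : pform P) s :
  (forall G, pnd G B -> pnd G C) -> derives s B -> derives s C.
Proof. by move=> BC [G sG GB]; exists G => //; apply: BC. Qed.

Lemma derives_and s B C : derives s (pAnd B C) <-> derives s B /\ derives s C.
Proof.
split=> [sBC|[[G sG GB] [G' sG' G'C]]].
  by split; apply: derives_map sBC => G; [apply: pnd_andE1 | apply: pnd_andE2].
exists (G ++ G'); first by move=> D /(@List.in_app_or _ _ _ _)[/sG|/sG'].
apply: pnd_andI.
  by apply: (pnd_weaken GB) => D ?; apply: List.in_or_app; left.
by apply: (pnd_weaken G'C) => D ?; apply: List.in_or_app; right.
Qed.

Lemma derives_orE s B C D : derives s (pOr B C) ->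
  derives s (pImp B D) -> derives s (pImp C D) -> derives s D.
Proof.
move=> sBC sBD sCD.
have impP : derives s (pImp (pAnd (pOr B C) (pAnd (pImp B D) (pImp C D))) D).
  exists [::] => //; apply: pnd_impI; set H := pAnd _ _.
  have HH G : List.In H G -> pnd G H by apply: pnd_ax.
  apply: (@pnd_orE _ _ B C); first by apply/(@pnd_andE1 _ _ _ _)/HH; left.
    apply: (@pnd_impE _ _ B); last by apply: pnd_ax; left.
    by apply/pnd_andE1/(@pnd_andE2 _ _ (pOr B C))/HH; right; left.
  apply: (@pnd_impE _ _ C); last by apply: pnd_ax; left.
  by apply/pnd_andE2/(@pnd_andE2 _ _ (pOr B C))/HH; right; left.
apply: (derives_mp impP); apply/derives_and; split=> //; exact/derives_and.
Qed.

Definition prime_theory s :=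
  [/\ ~ derives s pBot,
      forall i : I, derives s (nth pBot Phi i) -> i \in s
    & forall B C, List.In (pOr B C) Phi ->
        derives s (pOr B C) -> derives s B \/ derives s C].

Lemma axiom_index B : List.In B Phi -> exists i : I, B = nth pBot Phi i.
Proof.
elim: Phi => [//|C G IH] /= [<-|/IH[i ->]].
  by exists ord0.
by exists (lift ord0 i).
Qed.

Lemma subformulasE B C op : (op = @pAnd P \/ op = @pOr P \/ op = @pImp P) ->
  List.In (op B C) Phi -> List.In B Phi /\ List.In C Phi.
Proof.
move=> opP; rewrite {}/Phi; elim: A0 => [p|||/=|/=].
- by case: opP => [->|[->|->]] [].
- by case: opP => [->|[->|->]] [].
all: move=> D IHD E IHE.
all: have sub : List.In (op B C) (subformulas D ++ subformulas E) ->
    List.In B (subformulas D ++ subformulas E) /\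
    List.In C (subformulas D ++ subformulas E) by
  move=> /(@List.in_app_or _ _ _ _)[/IHD|/IHE] [??]; split;
    apply: List.in_or_app; by [left | right].
all: move=> /= [eqBC|/sub[??]]; last by split; right.
all: case: opP => [opE|[opE|opE]]; move: eqBC; rewrite opE // => -[<- <-].
all: split; right; apply: List.in_or_app; [left | right];
  exact: subformulas_self.
Qed.

(** A set of subformulas that is maximal among those not deriving [B] is prime:
    whatever it leaves out implies [B] over it, so it can neither derive a
    formula it leaves out nor a disjunction of two such formulas. *)
Lemma prime_extension s B : ~ derives s B ->
  exists t, [/\ prime_theory t, s \subset t & ~ derives t B].
Proof.
move=> NsB; pose Q := [pred t | `[< ~ derives t B >]].
have Qs : Q s by apply/asboolP.
have [t /maxsetP[/asboolP NtB maxt] st] := @maxset_exists _ Q s Qs.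
have add i : i \notin t -> derives t (pImp (nth pBot Phi i) B).
  move=> Nti; apply: derives_deduction; apply: contrapT => NiB.
  have it : i |: t = t by apply: maxt; [apply/asboolP | apply: subsetUr].
  by rewrite -it setU11 in Nti.
exists t; split=> //; split.
- by move=> tb; apply: NtB; apply: derives_map tb => G; apply: pnd_botE.
- move=> i ti; case: (boolP (i \in t)) => // /add iB.
  by case: NtB; apply: derives_mp ti.
- move=> C D inS tCD; apply: contrapT => /not_orP[NC ND]; apply: NtB.
  have [CS DS] := subformulasE (or_intror (or_introl erefl)) inS.
  have imp E : List.In E Phi -> ~ derives t E -> derives t (pImp E B).
    move=> /axiom_index[i ->] NE; apply: add; apply/negP => ti.
    by apply: NE; apply: derives_ax; exists i.
  by apply: derives_orE tCD _ _; apply: imp.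
Qed.

Definition canonical_world := {s : context | `[< prime_theory s >]}.
Definition canonical_le (u v : canonical_world) := val u \subset val v.

Lemma canonical_refl : reflexive canonical_le.
Proof. by move=> u; apply: subxx. Qed.
Lemma canonical_trans : transitive canonical_le.
Proof. by move=> v u w; apply: subset_trans. Qed.
Lemma canonical_anti : antisymmetric canonical_le.
Proof. by move=> u v uv; apply/val_inj/eqP; rewrite eqEsubset. Qed.

Definition canonical_poset :=
  KripkePoset canonical_refl canonical_trans canonical_anti.

Definition canonical_val (w : canonical_poset) (p : P) :=
  derives (val w) (pVar p).

Lemma canonical_truth B (w : canonical_poset) :
  List.In B Phi -> pforces canonical_val B w <-> derives (val w) B.
Proof.
elim: B w => [p|||/=|/=].
- by [].
- by move=> w _ /=; case: (asboolP _ (valP w)).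
all: move=> B IHB C IHC w inS; have [|BS CS] := subformulasE _ inS;
  first by auto.
- by rewrite derives_and /= IHB // IHC.
- rewrite IHB // IHC //; have [_ _ /(_ B C inS) pr] := asboolP _ (valP w).
  split=> [|/pr //] [d|d]; apply: derives_map d => G.
    exact: pnd_orI1.
  exact: pnd_orI2.
- split=> [wBC|wBC v wv /(IHB _ BS) vB]; last first.
    by apply/IHC => //; apply: derives_mp vB; apply: derives_sub wBC.
  have [i Bi] := axiom_index BS.
  apply: contrapT; rewrite Bi => NBC.
  have /prime_extension[t [pt st NtC]] : ~ derives (i |: val w) C.
    by move/derives_deduction.
  have pt' : `[< prime_theory t >] by apply/asboolP.
  pose v : canonical_poset := Sub t pt'.
  have wv : canonical_le w v by apply: subset_trans st; apply: subsetUr.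
  apply: NtC; apply/(IHC v CS)/wBC => //; apply/IHB => //.
  by apply: derives_ax; exists i => //; apply: (subsetP st); rewrite setU11.
Qed.

End CanonicalModel.

(** Contexts made of subformulas of [A] suffice, and there are finitely many. *)
Theorem IPC_finite_countermodel A : ~ IPC A ->
  exists (W : kripke_poset) (V : W -> P -> Prop) (w : W),
    (forall v u p, wle v u -> V v p -> V u p) /\ ~ pforces V A w.
Proof.
move=> NA; have /prime_extension[t [pt _ NtA]] : ~ derives (A0 := A) set0 A.
  by move/derives0.
have pt' : `[< prime_theory t >] by apply/asboolP.
exists (canonical_poset A), (@canonical_val A), (Sub t pt'); split.
  by move=> v u p vu; apply: derives_sub.
by move/(canonical_truth _ (subformulas_self A)).
Qed.

End PropositionalCompleteness.

(** * The universe of sets over a Kripke frame *)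

(** Only a preorder: in the ladders below, positions on the same level that agree
    modulo the width are equivalent nodes. *)
Record frame := Frame {
  node :> Type;
  fle : node -> node -> Prop;
  fle_refl : forall w, fle w w;
  fle_trans : forall u v w, fle u v -> fle v w -> fle u w
}.

Definition persistent (F : frame) (U : F -> Prop) :=
  forall v w, fle v w -> U v -> U w.

Section KripkeSets.

Variable F : frame.
Implicit Types u v w : F.

(** The sets of the Heyting-valued universe over the algebra of persistent
    predicates on [F]: the element [f i] belongs to the set at the nodes of [e i].
    Joins in this algebra are pointwise unions, so Heyting-valued truth becomes
    Kripke forcing with the same domain at all nodes. *)
Inductive kset : Type :=
  KSet (X : Type) (e : X -> F -> Prop) of (forall i, persistent (e i)) & (X -> kset).

Fixpoint keq (x y : kset) (w : F) : Prop :=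
  match x, y with
  | KSet X e _ f, KSet Y d _ g =>
      (forall i v, fle w v -> e i v -> exists2 j, d j v & keq (f i) (g j) v) /\
      (forall j v, fle w v -> d j v -> exists2 i, e i v & keq (f i) (g j) v)
  end.

Definition kmem (x y : kset) (w : F) : Prop :=
  let: KSet Y d _ g := y in exists2 j, d j w & keq x (g j) w.

Lemma keq_le x y : persistent (keq x y).
Proof.
case: x => X e he f; case: y => Y d hd g w v wv [xy yx].
by split=> i u /(fle_trans wv); [apply: xy | apply: yx].
Qed.

Lemma keq_refl x w : keq x x w.
Proof. by elim: x w => X e he f IH w; split=> i v _ ei; exists i. Qed.

Lemma keq_sym x y w : keq x y w -> keq y x w.
Proof.
elim: x y w => X e he f IH [Y d hd g] w [xy yx].
split=> i v wv iv; first by have [j ? /IH] := yx i v wv iv; exists j.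
by have [j ? /IH] := xy i v wv iv; exists j.
Qed.

Lemma keq_trans x y z w : keq x y w -> keq y z w -> keq x z w.
Proof.
elim: x y z w => X e he f IH [Y d hd g] [Z c hc h] w [xy yx] [yz zy].
split=> i v wv iv.
  have [j jv ij] := xy i v wv iv; have [k kv jk] := yz j v wv jv.
  by exists k => //; apply: IH ij jk.
have [j jv ij] := zy i v wv iv; have [k kv jk] := yx j v wv jv.
by exists k => //; apply: IH jk ij.
Qed.

Lemma kmem_le x y : persistent (kmem x y).
Proof.
case: y => Y d hd g w v wv [j jw xj]; exists j; first exact: hd jw.
exact: keq_le xj.
Qed.

Lemma kmem_congr x x' y y' w :
  keq x x' w -> keq y y' w -> kmem x y w -> kmem x' y' w.
Proof.
case: y y' => Y d hd g [Z c hc h] xx' [yy' _] [j jw xj].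
have [k kw jk] := yy' j w (fle_refl w) jw; exists k => //.
by apply: keq_trans (keq_sym xx') _; apply: keq_trans jk.
Qed.

Fixpoint forces (r : nat -> kset) (A : form) (w : F) : Prop :=
  match A with
  | fMem i j => kmem (r i) (r j) w
  | fEq i j => keq (r i) (r j) w
  | fBot => False
  | fAnd A B => forces r A w /\ forces r B w
  | fOr A B => forces r A w \/ forces r B w
  | fImp A B => forall v, fle w v -> forces r A v -> forces r B v
  | fAll A => forall x, forces (scons x r) A w
  | fEx A => exists x, forces (scons x r) A w
  end.

Lemma forces_le r A : persistent (forces r A).
Proof.
elim: A r => [i j|i j||A IHA B IHB|A IHA B IHB|A IHA B IHB|A IHA|A IHA] r w v wv /=.
- exact: kmem_le.
- exact: keq_le.
- by [].
- by case=> [/(IHA _ _ _ wv) ? /(IHB _ _ _ wv)].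
- by case=> [/(IHA _ _ _ wv)|/(IHB _ _ _ wv)]; [left | right].
- by move=> AB u /(fle_trans wv); apply: AB.
- by move=> wA x; apply: IHA (wA x).
- by case=> x wA; exists x; apply: IHA wA.
Qed.

Lemma forces_congr A r r' w :
  (forall i, keq (r i) (r' i) w) -> forces r A w -> forces r' A w.
Proof.
elim: A r r' w => [i j|i j||A IHA B IHB|A IHA B IHB|A IHA B IHB|A IHA|A IHA]
  r r' w rr' /=.
- exact: kmem_congr.
- move=> ij; apply: keq_trans (keq_sym (rr' i)) _.
  by apply: keq_trans (rr' j).
- by [].
- by case=> [/(IHA _ _ _ rr') ? /(IHB _ _ _ rr')].
- by case=> [/(IHA _ _ _ rr')|/(IHB _ _ _ rr')]; [left | right].
- move=> AB v wv vA.
  have r'r i : keq (r' i) (r i) v by apply/keq_sym/(keq_le wv).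
  apply: (IHB r) => [i|]; first exact/keq_sym.
  by apply: AB => //; apply: IHA vA.
- move=> wA x; apply: IHA (wA x) => -[|i] //=; exact: keq_refl.
- by move=> [x wA]; exists x; apply: IHA wA => -[|i] //=; exact: keq_refl.
Qed.

Lemma eq_forces A r r' w : r =1 r' -> forces r A w <-> forces r' A w.
Proof.
by move=> rr'; split; apply: forces_congr => i; rewrite rr'; apply: keq_refl.
Qed.

Lemma forces_ren f A r w : forces r (ren f A) w <-> forces (r \o f) A w.
Proof.
elim: A f r w => [i j|i j||A IHA B IHB|A IHA B IHB|A IHA B IHB|A IHA|A IHA] f r w //=.
- by rewrite IHA IHB.
- by rewrite IHA IHB.
- by split=> AB v wv; move: (AB v wv); rewrite IHA IHB.
- split=> wA x; have := wA x; rewrite IHA => h.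
    by apply: (iffLR (eq_forces A w _)) h; case.
  by apply: (iffLR (eq_forces A w _)) h; case.
- split=> -[x wA]; exists x; move: wA; rewrite IHA => h.
    by apply: (iffLR (eq_forces A w _)) h; case.
  by apply: (iffLR (eq_forces A w _)) h; case.
Qed.

Lemma forces_inst A t r w : forces r (inst A t) w <-> forces (scons (r t) r) A w.
Proof. by rewrite forces_ren; apply: eq_forces; case. Qed.

Lemma forces_ctx_shift x r G w : (forall B, List.In B G -> forces r B w) ->
  forall B, List.In B (map (ren S) G) -> forces (scons x r) B w.
Proof.
by move=> rG B; rewrite List.in_map_iff => -[C [<- /rG]]; rewrite forces_ren.
Qed.

Lemma nd_sound G A : nd G A -> forall r w,
  (forall B, List.In B G -> forces r B w) -> forces r A w.
Proof.
have ctx_cons r w B G' : forces r B w ->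
    (forall C, List.In C G' -> forces r C w) ->
    forall C, List.In C (B :: G') -> forces r C w.
  by move=> rB rG C [<-|/rG].
have ctx_le r w v G' : fle w v -> (forall C, List.In C G' -> forces r C w) ->
    forall C, List.In C G' -> forces r C v.
  by move=> wv rG C /rG; apply: forces_le.
elim=> {G A}.
- by move=> G A inG r w; apply.
- by move=> G A _ IH r w /IH.
- by move=> G A B _ IHA _ IHB r w rG; split; [apply: IHA | apply: IHB].
- by move=> G A B _ IH r w /IH[].
- by move=> G A B _ IH r w /IH[].
- by move=> G A B _ IH r w /IH; left.
- by move=> G A B _ IH r w /IH; right.
- move=> G A B C _ IH _ IHA _ IHB r w rG.
  by have [d|d] := IH r w rG; [apply: IHA | apply: IHB]; apply: ctx_cons.
- move=> G A B _ IH r w rG v wv vA; apply: IH; apply: ctx_cons => //.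
  exact: ctx_le rG.
- by move=> G A B _ IHA _ IHB r w rG; apply: IHA (fle_refl w) (IHB r w rG).
- by move=> G A _ IH r w rG x; apply: IH; apply: forces_ctx_shift.
- by move=> G A t _ IH r w rG; apply/forces_inst; apply: IH.
- by move=> G A t _ IH r w rG; exists (r t); apply/forces_inst/IH.
- move=> G A B _ IHA _ IHB r w rG; have [x xA] := IHA r w rG.
  have := IHB (scons x r) w; rewrite forces_ren; apply.
  by apply: ctx_cons => //; apply: forces_ctx_shift.
- by move=> *; apply: keq_refl.
- move=> G A s t _ IHe _ IHA r w rG; have := IHA r w rG.
  rewrite !forces_inst; apply: forces_congr => -[|i] /=; last exact: keq_refl.
  exact: IHe.
Qed.

Lemma forces_uclosure A : (forall r w, forces r A w) ->
  forall r w, forces r (uclosure A) w.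
Proof.
rewrite /uclosure => vA; elim: (fvbound A) => //= n IH r w x; exact: IH.
Qed.

Lemma forces_iff (U V : F -> Prop) w :
    (forall v, fle w v -> U v <-> V v) ->
  (forall v, fle w v -> U v -> V v) /\ (forall v, fle w v -> V v -> U v).
Proof. by move=> UV; split=> v wv /(UV v wv). Qed.

Definition kset_of (X : Type) (f : X -> kset) : kset :=
  @KSet X (fun _ _ => True) (fun _ _ _ _ => id) f.

Lemma forces_ext r w : forces r ax_ext w.
Proof.
move=> [X e he f] [Y d hd g] /= v _ xy; split=> i u vu iu.
  have [/(_ u vu) + _] := xy (f i); apply.
  by exists i => //; apply: keq_refl.
have [_ /(_ u vu)] := xy (g i); case; first by exists i => //; apply: keq_refl.
by move=> j ju ij; exists j => //; apply: keq_sym.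
Qed.

Lemma forces_empty r w : forces r ax_empty w.
Proof.
by exists (kset_of (of_void kset)) => x v _ /= -[[]].
Qed.

Lemma forces_pair r w : forces r ax_pair w.
Proof.
move=> a b; exists (kset_of (fun c : bool => if c then a else b)) => x.
apply: forces_iff => v _ /=; split=> [[[] _ ?]|[?|?]]; [by left | by right | |].
  by exists true.
by exists false.
Qed.

Lemma forces_union r w : forces r ax_union w.
Proof.
case=> X e he f.
pose dom x := let: KSet Y _ _ _ := x in Y.
pose deg x : dom x -> F -> Prop := let: KSet _ d _ _ := x in d.
pose elt x : dom x -> kset := let: KSet _ _ _ g := x in g.
have degP x j : persistent (deg x j) by case: x j.
have memE x y v : kmem x y v <-> exists2 j, deg y j v & keq x (elt y j) v.
  by case: y.
pose d (ij : {i : X & dom (f i)}) v := e (tag ij) v /\ deg _ (tagged ij) v.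
have dP ij : persistent (d ij).
  by move=> u v uv [i j]; split; [apply: he uv i | apply: degP uv j].
exists (KSet dP (fun ij => elt _ (tagged ij))) => x.
apply: forces_iff => v _ /=; split=> [[[i j] /= [iv jv] xj]|].
  exists (f i); split; first by exists i => //; apply: keq_refl.
  by apply/memE; exists j.
case=> y [[i iv yi] xy].
have /memE[j jv xj] := kmem_congr (keq_refl x v) yi xy.
by exists (existT _ i j).
Qed.

(** Every subset of [a = {f i | e i}] is, from the node where it is a subset on,
    equal to a set listing the same [f i] with other truth values; there is only
    a small collection of those because truth values live in [Prop]. *)
Lemma forces_power r w : forces r ax_power w.
Proof.
case=> X e he f.
(* The condition is imposed on all later nodes because [U] ranges over all
   families of predicates, persistent or not. *)
pose sub (U : X -> F -> Prop) := fun i v => forall u, fle v u -> e i u /\ U i u.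
have subP U i : persistent (sub U i).
  by move=> u v uv h z vz; apply: h; apply: fle_trans vz.
exists (kset_of (fun U => KSet (subP U) f)) => x.
apply: forces_iff => v _ /=; split=> [[U _ xU]|xX].
  move=> y u vu yx.
  have [i iU yi] := kmem_congr (keq_refl y u) (keq_le vu xU) yx.
  by exists i => //; have [] := iU u (fle_refl u).
exists (fun i u => kmem (f i) x u) => //.
case: x xX => Y d hd g xX; split=> i u vu iu.
  have [|j ju ij] := xX (g i) u vu; first by exists i => //; apply: keq_refl.
  exists j => // z uz; split; first exact: (he _ _ _ uz ju).
  by exists i; [apply: (hd _ _ _ uz iu) | apply/keq_sym/(keq_le uz)].
have [_ [j ju ij]] := iu u (fle_refl u).
by exists j => //; apply: keq_sym.
Qed.

(** The axiom of infinity only asks for a nonempty set each of whose elements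
    belongs to another one; iterated singletons do. *)
Fixpoint singleton_tower n : kset :=
  kset_of (fun _ : unit =>
    if n is m.+1 then singleton_tower m else kset_of (of_void kset)).

Lemma forces_infinity r w : forces r ax_infinity w.
Proof.
exists (kset_of singleton_tower); split.
  by exists (singleton_tower 0), 0 => //; apply: keq_refl.
move=> x v _ [n _ xn]; exists (singleton_tower n.+1); split.
  by exists n.+1 => //; apply: keq_refl.
by exists tt.
Qed.

Lemma forces_set_induction A r w : forces r (ax_set_induction A) w.
Proof.
move=> v _ ind x; elim: x v {w} ind => X e he f IH v ind /=.
apply: (ind _ v (fle_refl v)) => y u vu [i iu yi].
have step : forces r (fAll (fImp (fAllIn 0 (ren (up S) A)) A)) u.
  exact: forces_le vu ind.
have fiA := IH i u step; apply/forces_ren.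
apply: forces_congr fiA => -[|j] /=; last exact: keq_refl.
exact: keq_sym.
Qed.

Lemma forces_separation A r w : forces r (ax_separation A) w.
Proof.
case=> X e he f; set a := KSet he f.
pose d i v := e i v /\ forces (scons (f i) (scons a r)) A v.
have dP i : persistent (d i).
  by move=> u v uv [iu uA]; split; [apply: (he _ _ _ uv iu) | apply: forces_le uA].
exists (KSet dP f) => x; set b := KSet dP f.
have skip v : forces (scons x (scons b (scons a r))) (ren (up S) A) v <->
    forces (scons x (scons a r)) A v.
  by rewrite forces_ren; apply: eq_forces; case=> [|[|i]].
have subst i v : keq x (f i) v -> forces (scons x (scons a r)) A v <->
    forces (scons (f i) (scons a r)) A v.
  move=> xi; split; apply: forces_congr => -[|j] /=; try exact: keq_refl.
    exact: xi.
  exact: keq_sym.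
apply: forces_iff => v _ /=; split=> [[i [iv iA] xi]|[[i iv xi] /skip xA]].
  by split; [exists i | exact: (iffRL (skip v) (iffRL (subst i v xi) iA))].
by exists i => //; split=> //; exact: (iffLR (subst i v xi) xA).
Qed.

(** A witness depends on the node as well as on the element, so one is chosen for
    each pair of them. The collecting set may contain all these witnesses at all
    nodes, since collection puts no upper bound on it. *)
Lemma forces_collection A r w : forces r (ax_collection A) w.
Proof.
case=> X e he f; set a := KSet he f.
pose body (iv : X * F) y := forces (scons y (scons (f iv.1) (scons a r))) A iv.2.
have [iv|c cP] := @choice _ _ (fun iv y => (exists z, body iv z) -> body iv y).
  have [[y yA]|no] := pselect (exists y, body iv y); first by exists y.
  by exists a => /no.
move=> v _ tot; exists (kset_of c) => x u vu [i iu xi].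
have [|y yA] := tot (f i) u vu; first by exists i => //; apply: keq_refl.
exists (c (i, u)); split; first by exists (i, u) => //; apply: keq_refl.
apply/forces_ren; have := cP (i, u) (ex_intro _ y yA).
apply: forces_congr => -[|[|[|j]]] /=; try exact: keq_refl.
  exact: keq_sym.
exact: (keq_refl a).
Qed.

Theorem forces_IZF A r w : proves IZF A -> forces r A w.
Proof.
case=> G axG /nd_sound; apply=> B /axG; case=> [||||||C|C|C].
- exact: forces_ext.
- exact: forces_empty.
- exact: forces_pair.
- exact: forces_union.
- exact: forces_power.
- exact: forces_infinity.
- exact/forces_uclosure/forces_set_induction.
- exact/forces_uclosure/forces_separation.
- exact/forces_uclosure/forces_collection.
Qed.

End KripkeSets.

(** * Sentences that measure the width of the frame *)

Definition big_or (T : Type) (f : T -> form) (s : seq T) : form :=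
  foldr (fun t => fOr (f t)) fBot s.

Lemma forces_big_or (F : frame) (T : eqType) (f : T -> form) s r (w : F) :
  forces r (big_or f s) w <-> exists2 t, t \in s & forces r (f t) w.
Proof.
elim: s => [|t s IH] /=; first by split=> [|[]].
rewrite IH; split=> [[tw|[u us uw]]|[u]].
- by exists t; rewrite ?mem_head.
- by exists u; rewrite // inE us orbT.
- by rewrite inE => /orP[/eqP->|us] uw; [left | right; exists u].
Qed.

Lemma fvbound_big_or (T : eqType) (f : T -> form) s n :
  (forall t, t \in s -> fvbound (f t) <= n) -> fvbound (big_or f s) <= n.
Proof.
elim: s => //= t s IH fn; rewrite geq_max fn ?mem_head //=.
by apply: IH => u us; rewrite fn // inE us orbT.
Qed.

Lemma forces_neg (F : frame) r A (w : F) :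
  forces r (fImp A fBot) w <-> forall v, fle w v -> ~ forces r A v.
Proof. by []. Qed.

(** Inhabitedness lets an arbitrary set stand for a truth value, and every truth
    value arises in this way. Quantifying over sets thus gives propositional
    quantifiers. *)
Definition inhabited_at (i : nat) : form := fEx (fMem 0 i.+1).

(** The universal closure of the bounded-width formula known from intermediate
    logics. *)
Definition no_antichain (k : nat) : form :=
  iter k fAll (big_or (fun i => fImp (inhabited_at i)
    (big_or inhabited_at [seq j <- iota 0 k | j != i])) (iota 0 k)).

Lemma sentence_no_antichain k : sentence (no_antichain k).
Proof.
have impP A B : fvbound A <= k -> fvbound B <= k -> fvbound (fImp A B) <= k.
  by move=> Ak Bk; rewrite geq_max Ak.
have iterP n A : fvbound (iter n fAll A) = fvbound A - n.
  by elim: n => [|n IH] /=; rewrite ?subn0 // IH subnS.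
have inh i : i < k -> fvbound (inhabited_at i) <= k by [].
rewrite /sentence iterP; apply/eqP; rewrite subn_eq0.
apply: fvbound_big_or => i; rewrite mem_iota => /inh ik.
apply: impP ik _; apply: fvbound_big_or => j.
by rewrite mem_filter mem_iota => /andP[_ /inh].
Qed.

(** Absence of antichains persists, presence does not: the negation therefore
    asks for an antichain of size [d] above every later node. *)
Definition width_is (d : nat) : form :=
  fAnd (no_antichain d.+1) (fImp (no_antichain d) fBot).

Lemma sentence_width_is d : sentence (width_is d).
Proof.
have no k : fvbound (no_antichain k) = 0 := sentence_no_antichain k.
rewrite /sentence -[LHS]/(maxn (fvbound (no_antichain d.+1))
  (maxn (fvbound (no_antichain d)) 0)).
by rewrite !no.
Qed.

Section Width.

Variable F : frame.
Implicit Types u v w : F.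

Definition antichain_above (k : nat) w := exists a : nat -> F,
  (forall i, i < k -> fle w (a i)) /\
  (forall i j, i < k -> j < k -> fle (a i) (a j) -> i = j).

(** The last quantifier binds index 0, and so the family [s] is read off in the
    same order as the indices. *)
Lemma forces_iter_all n A r w : forces r (iter n fAll A) w <->
  forall s : nat -> kset F,
    forces (fun i => if i < n then s i else r (i - n)) A w.
Proof.
have env (s : nat -> kset F) x r' m :
    (fun i => if i < m then s i else scons x r' (i - m)) =1
    (fun i => if i < m.+1 then (if i == m then x else s i) else r' (i - m.+1)).
  move=> i; rewrite ltnS; case: (ltngtP i m) => [//|mi|->]; last by rewrite subnn.
  by rewrite -(subnSK mi).
elim: n r => [|n IH] r /=.
  have E (s : nat -> kset F) : (fun i => if i < 0 then s i else r (i - 0)) =1 r.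
    by move=> i; rewrite ltn0 subn0.
  split=> [h s|/(_ r)]; first by apply: (iffRL (eq_forces A w (E s))).
  by apply: (iffLR (eq_forces A w (E r))).
split=> [h s|h x].
  have /IH /(_ s) := h (s n); apply: (iffLR (eq_forces A w _)) => i.
  by rewrite env; case: eqP => // ->.
apply/IH => s; apply: (iffRL (eq_forces A w (env s x r n))).
exact: (h (fun i => if i == n then x else s i)).
Qed.

Definition truth_value (U : F -> Prop) (persU : persistent U) : kset F :=
  @KSet F unit (fun _ => U) (fun _ => persU) (fun _ => kset_of (of_void _)).

Lemma kmem_truth_value U (persU : persistent U) w :
  (exists x, kmem x (truth_value persU) w) <-> U w.
Proof.
split=> [[x [_ //]]|Uw].
by exists (kset_of (of_void _)), tt => //; apply: keq_refl.
Qed.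

(** An antichain [a] refutes the formula when [p_i] is the set of nodes above
    [a i]. Conversely, if all disjuncts fail then for each [i] some node forces
    [p_i] and no other [p_j], and these nodes are incomparable by persistence. *)
Lemma forces_no_antichain k r w :
  forces r (no_antichain k) w <-> ~ antichain_above k w.
Proof.
rewrite /no_antichain forces_iter_all; split=> [all [a [wa aa]]|noa s].
  have pers i : persistent (fle (a i)) by move=> u v uv au; apply: fle_trans uv.
  have /forces_big_or[i] := all (fun i => truth_value (pers i)).
  rewrite mem_iota /= add0n => ik /(_ (a i) (wa i ik)) imp.
  have [|j] := iffLR (forces_big_or _ _ _ _) (imp _).
    by rewrite ik; apply/kmem_truth_value/fle_refl.
  rewrite mem_filter mem_iota add0n => /and3P[ji _ jk].
  rewrite /= jk => /kmem_truth_value.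
  by move/(aa _ _ jk ik)/eqP; rewrite (negPf ji).
pose r' i := if i < k then s i else r (i - k).
apply/forces_big_or; apply: contrapT => none; apply: noa.
pose only i v := fle w v /\ forces r' (inhabited_at i) v /\
  forall j, j < k -> j != i -> ~ forces r' (inhabited_at j) v.
have [i|a aP] := @choice nat F (fun i v => i < k -> only i v).
  have [ik|] := boolP (i < k); last by exists w.
  apply: contrapT => noi; apply: none; exists i; first by rewrite mem_iota.
  move=> v wv vi; apply/forces_big_or; apply: contrapT => noj; apply: noi.
  exists v => _; split=> //; split=> // j jk ji vj; apply: noj.
  by exists j => //; rewrite mem_filter ji mem_iota.
exists a; split=> [i /aP[] //|i j ik jk aij].
apply/eqP; apply: contrapT => /negP ij.
have [_ [_ /(_ i ik ij)]] := aP j jk; apply.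
by have [_ [+ _]] := aP i ik; apply: forces_le.
Qed.

Lemma forces_width_is d r w : forces r (width_is d) w <->
  ~ antichain_above d.+1 w /\ forall v, fle w v -> ~ ~ antichain_above d v.
Proof.
have noE k v := forces_no_antichain k r v.
split=> -[no_dS no_d]; split; try exact/noE.
  by move=> v wv no; apply: (no_d v wv); apply/noE.
by move=> v wv /noE; apply: no_d wv.
Qed.

End Width.

(** * Frames with ladders *)

Section Ladders.

Variable W : kripke_poset.

(** Any injective assignment of positive widths would do. *)
Definition width (v : W) : nat := (enum_rank v).+1.

Lemma width_inj : injective width.
Proof. by move=> u v [/val_inj/enum_rank_inj]. Qed.

(** [inl a] is the world [a]; [inr (v, (n, i))] is position [i] on level [n] of the
    ladder of [v]. Positions are read modulo the width. *)
Definition ladder_node : Type := W + W * (nat * nat).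

Definition ladder_le (x y : ladder_node) : bool :=
  match x, y with
  | inl a, inl b => wle a b
  | inl a, inr (b, _) => wle a b
  | inr (a, (n, i)), inr (b, (m, j)) =>
      (a == b) && ((n < m) || ((n == m) && (i == j %[mod width a])))
  | inr _, inl _ => false
  end.

Lemma ladder_le_refl x : ladder_le x x.
Proof.
by case: x => [a|[a [n i]]] /=; rewrite ?wle_refl // !eqxx orbT.
Qed.

Lemma ladder_le_trans x y z : ladder_le x y -> ladder_le y z -> ladder_le x z.
Proof.
case: x => [a|[a [n i]]]; case: y => [b|[b [m j]]]; case: z => [c|[c [l k]]] //=.
- exact: wle_trans.
- exact: wle_trans.
- by move=> ab /andP[/eqP<-].
case/andP=> /eqP<- nm /andP[/eqP<- ml]; rewrite eqxx /=.
case/orP: nm => [nm|/andP[/eqP-> /eqP->]] //.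
by case/orP: ml => [/(ltn_trans nm)->|/andP[/eqP<- _]] //; rewrite nm.
Qed.

Definition ladder_frame : frame :=
  @Frame ladder_node ladder_le ladder_le_refl ladder_le_trans.

Definition reach (x : ladder_frame) : {set W} :=
  match x with inl a => [set v | wle a v] | inr (a, _) => [set a] end.

Lemma reach_le x y : ladder_le x y -> reach y \subset reach x.
Proof.
move=> xy; apply/subsetP=> v; move: xy.
case: x => [a|[a [n i]]]; case: y => [b|[b [m j]]] //=; rewrite !inE.
- exact: wle_trans.
- by move=> ab /eqP->.
- by case/andP=> /eqP->.
Qed.

Lemma reach_ladder v x : v \in reach x ->
  exists nj, ladder_le x (inr (v, nj)).
Proof.
case: x => [a|[a nj]]; rewrite inE; first by exists (0, 0).
by move/eqP->; exists nj; apply: ladder_le_refl.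
Qed.

(** Nodes on different levels of a ladder are comparable, hence an antichain lies
    on one level, where positions are told apart by their residues. The next
    level is such an antichain of maximal size. *)
Lemma antichain_ladder k v nj :
  antichain_above k (inr (v, nj) : ladder_frame) <-> k <= width v.
Proof.
case: nj => n j; split=> [[a [wa aa]]|kv].
  have aE i : i < k -> exists ml, a i = inr (v, ml).
    by move/wa; case: (a i) => [//|[u [m l]]] /= /andP[/eqP<- _]; exists (m, l).
  pose res (i : 'I_k) : 'I_(width v) :=
    if a i is inr (_, (_, l)) then Ordinal (ltn_pmod l (isT : 0 < width v)) else ord0.
  suff /leq_card : injective res by rewrite !card_ord.
  move=> i i'; rewrite /res.
  have [[m l] ai] := aE i (ltn_ord i); have [[m' l'] ai'] := aE i' (ltn_ord i').
  have := aa i i' (ltn_ord i) (ltn_ord i'); have := aa i' i (ltn_ord i') (ltn_ord i).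
  rewrite ai ai' /= !eqxx /= => le_i'i le_ii' [ll']; apply: val_inj.
  case: (ltngtP m m') => mm'.
  - by apply: le_ii'; rewrite mm'.
  - by apply/esym/le_i'i; rewrite mm'.
  - by apply: le_ii'; rewrite mm' ll' !eqxx orbT.
exists (fun i => inr (v, (n.+1, i))); split=> [i _|i i' ik ik'] /=.
  by rewrite eqxx ltnSn.
rewrite !eqxx ltnn /= !modn_small; try exact: leq_trans kv.
by move/eqP.
Qed.

Lemma forces_width_is_ladder d r v nj :
  forces r (width_is d) (inr (v, nj) : ladder_frame) <-> width v = d.
Proof.
rewrite forces_width_is antichain_ladder; split=> [[dv vd]|<-].
  apply/eqP; rewrite eqn_leq leqNgt; apply/andP; split; first exact/negP.
  apply: contrapT => Nvd; apply: (vd _ (ladder_le_refl _)).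
  by rewrite antichain_ladder.
split; first by rewrite ltnn.
case: nj => n j [//|[u [n' j']]] /andP[/eqP<- _].
by rewrite antichain_ladder leqnn.
Qed.

Definition reach_avoids (E : {set W}) : form :=
  fImp (big_or (fun v => width_is (width v)) (enum E)) fBot.

(** Above every node there are ladder nodes, and on a ladder truth of the width
    sentences is constant. Under a negation it is enough to look at those. *)
Lemma forces_reach_avoids E r (x : ladder_frame) :
  forces r (reach_avoids E) x <-> reach x \subset ~: E.
Proof.
rewrite forces_neg; split=> [av|xE y xy /forces_big_or[v]].
  apply/subsetP=> v /reach_ladder[nj xv]; rewrite inE; apply/negP => vE.
  apply: (av _ xv); apply/forces_big_or; exists v; rewrite ?mem_enum //.
  exact/forces_width_is_ladder.
rewrite mem_enum => vE yv.
have [u uy] : exists u, u \in reach y.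
  by case: (y) => [a|[a nj]]; exists a; rewrite inE // wle_refl.
have [nj yu] := reach_ladder uy.
have /forces_width_is_ladder/width_inj uv :=
  forces_le (yu : fle y (inr (u, nj) : ladder_frame)) yv.
have := subsetP xE u (subsetP (reach_le xy) u uy).
by rewrite inE uv vE.
Qed.

(** Reach shrinks along the order, so a predicate is definable as soon as it is
    inherited by nodes of smaller reach: the sentence says that the reach is
    contained in a set of worlds which is small enough to ensure [U]. *)
Definition reach_sentence (U : ladder_frame -> Prop) : form :=
  big_or (fun R => reach_avoids (~: R))
    [seq R : {set W} <- enum {: {set W}} | `[< forall x, reach x \subset R -> U x >]].

Lemma forces_reach_sentence U r x :
  (forall y z, reach z \subset reach y -> U y -> U z) ->
  forces r (reach_sentence U) x <-> U x.
Proof.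
move=> detU; rewrite forces_big_or; split=> [[R]|Ux].
  rewrite mem_filter => /andP[/asboolP RU _] /forces_reach_avoids.
  by rewrite setCK => /RU.
exists (reach x); last by apply/forces_reach_avoids; rewrite setCK.
by rewrite mem_filter mem_enum andbT; apply/asboolP => y /detU; apply.
Qed.

Lemma sentence_reach_sentence U : sentence (reach_sentence U).
Proof.
apply/eqP; rewrite -leqn0; apply: fvbound_big_or => R _.
rewrite /= maxn0; apply: fvbound_big_or => v _.
by rewrite sentence_width_is.
Qed.

(** A world with the fewest successors among those above [v] is maximal. *)
Lemma maximal_above (v : W) :
  exists m : W, wle v m /\ forall u, wle m u -> u = m.
Proof.
case: (@arg_minnP _ v (wle v) (fun m => #|[set u | wle m u]|) (wle_refl v)).
move=> m vm minm; exists m; split=> // u mu; apply: wle_anti.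
rewrite mu andbT; have sub : [set x | wle u x] \subset [set x | wle m x].
  by apply/subsetP=> x; rewrite !inE; apply: wle_trans.
have /setP/(_ m) : [set x | wle u x] = [set x | wle m x].
  by apply/eqP; rewrite eqEcard sub minm //; apply: wle_trans mu.
by rewrite !inE wle_refl.
Qed.

Variables (P : Type) (V : W -> P -> Prop).
Hypothesis V_le : forall v u p, wle v u -> V v p -> V u p.

(** Sending each world to itself and the ladder of [v] to a maximal world [m v]
    above [v] is a bounded morphism [h] onto [W], so a valuation pulled back along
    [h] forces the same formulas. The pulled back valuation is definable because
    [h] is determined by the reach: if [reach y] is contained in [reach x] then
    [h x] lies below [h y]. *)
Theorem ladder_countermodel : exists s : P -> form,
  (forall p, sentence (s p)) /\
  forall A r w, forces r (ptrans s A) (inl w : ladder_frame) <-> pforces V A w.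
Proof.
have [m /all_and2[le_m max_m]] := choice maximal_above.
pose h (x : ladder_frame) : W := match x with inl a => a | inr (a, _) => m a end.
have h_mono x y : reach y \subset reach x -> wle (h x) (h y).
  case: x => [a|[a nj]]; case: y => [b|[b mk]] /= /subsetP sub.
  - by move: (sub b); rewrite !inE wle_refl; apply.
  - by apply: wle_trans (le_m b); move: (sub b); rewrite !inE eqxx; apply.
  (* Here [reach y] contains [b] and [m b] but has a single element, so [b] is
     itself maximal. *)
  - have := sub b; have := sub (m b).
    rewrite !inE wle_refl le_m => /(_ isT)/eqP mb /(_ isT)/eqP ba.
    by rewrite -ba mb ba wle_refl.
  - by move: (sub b); rewrite !inE eqxx => /(_ isT)/eqP->; rewrite wle_refl.
have h_back x v : wle (h x) v -> exists2 y, ladder_le x y & h y = v.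
  case: x => [a|[a nj]] /= av; first by exists (inl v).
  exists (inr (a, nj)); last by rewrite (max_m _ _ av).
  exact: (ladder_le_refl (inr (a, nj))).
pose s p := reach_sentence (fun x => V (h x) p).
exists s; split=> [p|A r w]; first exact: sentence_reach_sentence.
rewrite -[in X in _ <-> X]/(h (inl w)).
elim: A (inl w : ladder_frame) => [p|||/=|/=] //=.
- by move=> x; apply: forces_reach_sentence => y z /h_mono; apply: V_le.
- by move=> B IHB C IHC x; rewrite IHB IHC.
- by move=> B IHB C IHC x; rewrite IHB IHC.
move=> B IHB C IHC x; split=> [BC v xv vB|BC y xy /IHB yB].
  have [y xy hy] := h_back _ _ xv.
  by rewrite -hy in vB *; apply/IHC/BC/IHB.
by apply/IHC/BC => //; apply/h_mono/reach_le.
Qed.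

End Ladders.

(** * The de Jongh property *)

Lemma ptrans_nd (P : Type) (s : P -> form) G (A : pform P) :
  pnd G A -> nd (map (ptrans s) G) (ptrans s A).
Proof.
elim=> {G A} /=.
- by move=> G A inG; apply: nd_ax; apply: List.in_map.
- by move=> G A _; apply: nd_botE.
- by move=> G A B _ IHA _ IHB; apply: nd_andI.
- by move=> G A B _; apply: nd_andE1.
- by move=> G A B _; apply: nd_andE2.
- by move=> G A B _; apply: nd_orI1.
- by move=> G A B _; apply: nd_orI2.
- by move=> G A B C _ IH _ IHA _ IHB; apply: nd_orE IH IHA IHB.
- by move=> G A B _; apply: nd_impI.
- by move=> G A B _ IHA _ IHB; apply: nd_impE IHA IHB.
Qed.

Theorem corollary35 (P : countType)
  (ctm : exists M : vset, [/\ vcountable M, vtransitive M & models M ZFC]) :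
  de_jongh_property P IZF.
Proof.
move=> A; split=> [provable|ipcA s _]; last by exists [::] => //; apply: ptrans_nd ipcA.
apply: contrapT => /IPC_finite_countermodel[W [V [w [V_le NwA]]]].
have [s [sent sP]] := ladder_countermodel V_le; apply: NwA.
apply/(sP A (fun _ => kset_of (of_void _))).
exact/forces_IZF/provable.
Qed.
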